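(* Let $q$ be a power of an odd prime $p$, let $n=2^{e_0}p_1^{e_1}\cdots p_s^{e_s}$, where $p_1,\dots,p_s$ are distinct odd primes different from $p$ and $e_0,e_1,\dots,e_s$ are positive integers, let $n'=p_1^{e_1}\cdots p_s^{e_s}$, and let $\eta$ be a primitive root system modulo $n'$. Then a full set of representatives of the $q$-cyclotomic cosets modulo $n$ (one representative for each coset) is given by $$\mathcal{CR}_{n/q}=\Big(\bigsqcup_{(y,x)\in\Sigma^+(n';q)}\mathcal{CR}_{(y,x)}^+\Big)\sqcup\Big(\bigsqcup_{(y,x)\in\Sigma^-(n';q)}\mathcal{CR}_{(y,x)}^-\Big).$$
   Context: For $N\ge1$ coprime to $q$, the $q$-cyclotomic coset modulo $N$ containing an integer $\gamma$ is $c_{N/q}(\gamma)=\{\gamma q^j\bmod N:j\ge0\}\subseteq\mathbb{Z}/N\mathbb{Z}$. An $s$-tuple $\eta=(\eta_1,\dots,\eta_s)$ of integers is a primitive root system modulo $n'=p_1^{e_1}\cdots p_s^{e_s}$ if for every $i$: $\eta_i$ is a primitive root modulo $p_i^{d}$ for all $d\ge1$, and $\eta_i\equiv1\pmod{p_j^{e_j}}$ for every $j\ne i$. For $0\le y_i\le e_i$ put $f_{i,y_i}=\mathrm{ord}_{p_i^{e_i-y_i}}(q)$ ($\mathrm{ord}_1(q)=1$), $g_{i,y_i}=\phi(p_i^{e_i-y_i})/f_{i,y_i}$. $\Sigma(n';q)$ is the set of $2s$-tuples of integers $(y,x)=(y_1,\dots,y_s,x_1,\dots,x_s)$ with $0\le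 y_i\le e_i$ and $0\le x_i\le g_{i,y_i}\gcd(\mathrm{lcm}(f_{1,y_1},\dots,f_{i-1,y_{i-1}}),f_{i,y_i})-1$ for all $i$ (for $i=1$ the gcd is understood to be $1$). $\eta^{(y,x)}=\eta_1^{x_1}\cdots\eta_s^{x_s}p_1^{y_1}\cdots p_s^{y_s}$; $\tau_y=\mathrm{lcm}(f_{1,y_1},\dots,f_{s,y_s})$. $\Sigma^+(n';q)$ (resp. $\Sigma^-(n';q)$) is the set of $(y,x)\in\Sigma(n';q)$ with $q^{\tau_y}\equiv1$ (resp. $3$) $\pmod4$. For an integer $\gamma$, $\varphi_{n'}(\gamma)=\sum_{k\ge0}\phi_{n',k}(\gamma)2^k$, $\phi_{n',k}(\gamma)\in\{0,1\}$, is the unique formal $2$-adic power series with $2^{i+1}\mid\gamma+n'\sum_{k=0}^i\phi_{n',k}(\gamma)2^k$ for all $i\ge0$; and for $d\ge0$, $U_d(\gamma)=\sum_{k=0}^{d-1}\phi_{n',k}(\gamma)2^k+(1-\phi_{n',d}(\gamma))2^d$. For $(y,x)\in\Sigma^+(n';q)$ and $0\le d\le e_0$: $v^+(y)=v_2(q^{\tau_y}-1)$, $s_{y,d}^+=\min\{e_0-d-1,v^+(y)-1\}$, and for $t\in\{0,1\}^{s_{y,d}^+}$, $$\mu(y,x)_{d,t}^+=\eta^{(y,x)}+n'\Big(U_d(\eta^{(y,x)})+\sum_{j=1}^{s_{y,d}^+}t_j2^{d+j}\Big),\quad \mathcal{CR}_{(y,x)}^+=\{\mu(y,x)_{d,t}^+:0\le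 d\le e_0,\ t\in\{0,1\}^{s_{y,d}^+}\}.$$ For $(y,x)\in\Sigma^-(n';q)$ and $0\le d\le e_0$: $v^-(y)=v_2(q^{\tau_y}+1)$, $s_{y,d}^-=\min\{e_0-d-2,v^-(y)-1\}$, and for $t\in\{0,1\}^{s_{y,d}^-}$, $$\mu(y,x)_{d,t}^-=\eta^{(y,x)}+n'\Big(U_d(\eta^{(y,x)})+\sum_{j=1}^{s_{y,d}^-}t_j2^{d+j+1}\Big),\quad \mathcal{CR}_{(y,x)}^-=\{\mu(y,x)_{d,t}^-:0\le d\le e_0,\ t\in\{0,1\}^{s_{y,d}^-}\}.$$ When the exponent $s_{y,d}^{\pm}\le0$, $\{0,1\}^{s_{y,d}^\pm}$ is the one-element set $\{0\}$ and the sum over $j$ is empty. Representatives are regarded modulo $n$. *)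

(* Defs.v *)
From HB Require Import structures.
From mathcomp Require Import all_boot all_order all_algebra.
From mathcomp Require Import boolp classical_sets zify.

Set Implicit Arguments.
Unset Strict Implicit.
Unset Printing Implicit Defensive.

Import Order.TTheory GRing.Theory Num.Theory.
Local Open Scope classical_set_scope.
Local Open Scope ring_scope.

(* Multiplicative order of a modulo m, for m >= 1.  When a is coprime to m the
   order is at most m; otherwise the list is empty and the value is 0, which
   is never a totient of a positive integer.  In particular mord 1 a = 1. *)
Definition mord (m : nat) (a : int) : nat :=
  head 0%N [seq k <- iota 1 m | (a ^+ k == 1 %[mod m])%Z].

Definition primitive_root_mod (m : nat) (a : int) : Prop :=
  mord m a = totient m.

(* 'Z_N is Z/NZ only for N > 1. *)
Definition cyclotomic_coset (N q : nat) (gamma : int) : set 'Z_N :=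
  [set (gamma * q%:Z ^+ j)%:~R | j in [set: nat]].

Arguments cyclotomic_coset : clear implicits.

Definition cyclotomic_cosets (N q : nat) : set (set 'Z_N) :=
  [set C | exists gamma : int, C = cyclotomic_coset N q gamma].

Arguments cyclotomic_cosets : clear implicits.

Definition full_set_of_representatives (N q : nat) (X : set 'Z_N) : Prop :=
  forall C, cyclotomic_cosets N q C -> exists! r, (X `&` C) r.

Arguments full_set_of_representatives : clear implicits.

(* The coefficients phi_{m,k}(gamma) for m odd: the partial sum S of the first
   k terms satisfies 2^k | gamma + m * S, and the next coefficient is forced to
   be the parity of the quotient.  By digit_spec and digit_unique, this is the
   unique sequence satisfying the defining divisibility conditions is_digits. *)
Definition next_digit (m : nat) (gamma : int) (k S : nat) : bool :=
  ~~ (2 %| (gamma + m%:Z * S%:Z) %/ (2 ^ k)%N)%Z.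

Fixpoint digit_sum (m : nat) (gamma : int) (d : nat) : nat :=
  if d is k.+1 then
    let S := digit_sum m gamma k in (S + next_digit m gamma k S * 2 ^ k)%N
  else 0%N.

Definition digit (m : nat) (gamma : int) (k : nat) : bool :=
  next_digit m gamma k (digit_sum m gamma k).

Definition is_digits (m : nat) (gamma : int) (phi : nat -> bool) : Prop :=
  forall i, ((2 ^ i.+1)%N %|
             gamma + m%:Z * (\sum_(k < i.+1) phi k * 2 ^ k)%N%:Z)%Z.

Lemma digit_sumE m gamma d :
  digit_sum m gamma d = (\sum_(k < d) digit m gamma k * 2 ^ k)%N.
Proof. by elim: d => [|d IH]; rewrite ?big_ord0 // big_ord_recr /= -IH. Qed.

Lemma dvdz2_odd_add (m : nat) (a : int) (b : bool) : odd m ->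
  (2 %| a + m%:Z * (b : nat)%:Z)%Z = (b == ~~ (2 %| a)%Z).
Proof. by move=> om; case: b; apply/idP/idP; lia. Qed.

Lemma dvdz_next_digit m gamma k S (b : bool) : odd m ->
  ((2 ^ k)%N %| gamma + m%:Z * S%:Z)%Z ->
  ((2 ^ k.+1)%N %| gamma + m%:Z * (S + b * 2 ^ k)%N%:Z)%Z
    = (b == next_digit m gamma k S).
Proof.
move=> om /dvdzP[t Et]; have k0 : (2 ^ k)%N%:Z != 0 by rewrite eqz_nat expn_eq0.
rewrite /next_digit Et mulzK // -(dvdz2_odd_add _ _ om).
rewrite PoszD mulrDr addrA Et PoszM mulrA -mulrDl expnS PoszM.
by rewrite dvdz_mul2r ?(negPf k0) // absz_nat.
Qed.

Lemma digit_spec m gamma : odd m -> is_digits m gamma (digit m gamma).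
Proof.
move=> om i; rewrite -digit_sumE; elim: i.+1 => [|k IH]; first exact: dvd1z.
by rewrite /= dvdz_next_digit.
Qed.

Lemma digit_unique m gamma phi :
  odd m -> is_digits m gamma phi -> phi =1 digit m gamma.
Proof.
move=> om Hphi k.
suff [_ ->] : (\sum_(j < k) phi j * 2 ^ j)%N = digit_sum m gamma k
              /\ phi k = digit m gamma k by [].
have step n : (\sum_(j < n) phi j * 2 ^ j)%N = digit_sum m gamma n ->
    phi n = digit m gamma n.
  move=> E; have := Hphi n; rewrite big_ord_recr /= E dvdz_next_digit //.
    by move/eqP.
  case: n E => [|n] E; first exact: dvd1z.
  by rewrite -E; apply: Hphi.
elim: k => [|k [E1 E2]].
  by split; [rewrite big_ord0 | apply: step; rewrite big_ord0].
have E : (\sum_(j < k.+1) phi j * 2 ^ j)%N = digit_sum m gamma k.+1.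
  by rewrite big_ord_recr /= E1 E2.
by split=> //; apply: step.
Qed.

Definition U_ (m d : nat) (gamma : int) : nat :=
  (\sum_(k < d) digit m gamma k * 2 ^ k
   + (1 - digit m gamma d) * 2 ^ d)%N.

Section Representatives.

Context (q e0 s : nat) (p e : 'I_s -> nat) (eta : 'I_s -> int).

Definition nprime : nat := (\prod_(i < s) p i ^ e i)%N.

Definition primitive_root_system : Prop :=
  forall i, (forall d, (0 < d)%N -> primitive_root_mod (p i ^ d)%N (eta i)) /\
            (forall j, j != i -> (eta i = 1 %[mod (p j ^ e j)%N])%Z).

Definition f_ (i : 'I_s) (yi : nat) : nat := mord (p i ^ (e i - yi))%N q.

Definition g_ (i : 'I_s) (yi : nat) : nat :=
  (totient (p i ^ (e i - yi))%N %/ f_ i yi)%N.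

(* An element of Sigma is a pair (y, x). *)
Definition pair_yx : Type := ({ffun 'I_s -> nat} * {ffun 'I_s -> nat})%type.

(* The lcm over j < i is 1 for the first index, so that the gcd is 1 there. *)
Definition Sigma : set pair_yx :=
  [set yx : pair_yx | forall i : 'I_s,
     (yx.1 i <= e i)%N /\
     (yx.2 i < g_ i (yx.1 i) *
        gcdn (\big[lcmn/1]_(j < s | (j < i)%N) f_ j (yx.1 j)) (f_ i (yx.1 i)))%N].

Definition eta_pow (yx : pair_yx) : int :=
  (\prod_(i < s) eta i ^+ yx.2 i) * (\prod_(i < s) (p i)%:Z ^+ yx.1 i).

Definition tau (yx : pair_yx) : nat := \big[lcmn/1%N]_(i < s) f_ i (yx.1 i).

Definition Sigma_plus : set pair_yx :=
  [set yx : pair_yx | Sigma yx /\ (q ^ tau yx = 1 %[mod 4])%N].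

Definition Sigma_minus : set pair_yx :=
  [set yx : pair_yx | Sigma yx /\ (q ^ tau yx = 3 %[mod 4])%N].

Definition v_plus (yx : pair_yx) : nat := logn 2 (q ^ tau yx - 1)%N.
Definition v_minus (yx : pair_yx) : nat := logn 2 (q ^ tau yx + 1)%N.

(* Truncated subtraction: a nonpositive exponent becomes 0, and then t ranges
   over a one-element type and the sum over t is empty. *)
Definition s_plus (yx : pair_yx) (d : nat) : nat :=
  minn (e0 - d - 1)%N (v_plus yx - 1)%N.
Definition s_minus (yx : pair_yx) (d : nat) : nat :=
  minn (e0 - d - 2)%N (v_minus yx - 1)%N.

(* The index j : 'I_k stands for the 1-based index j.+1. *)
Definition mu_plus (yx : pair_yx) (d : nat)
    (t : {ffun 'I_(s_plus yx d) -> bool}) : int :=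
  eta_pow yx + nprime%:Z *
    (U_ nprime d (eta_pow yx) +
     \sum_(j < s_plus yx d) t j * 2 ^ (d + j.+1))%N%:Z.

Definition mu_minus (yx : pair_yx) (d : nat)
    (t : {ffun 'I_(s_minus yx d) -> bool}) : int :=
  eta_pow yx + nprime%:Z *
    (U_ nprime d (eta_pow yx) +
     \sum_(j < s_minus yx d) t j * 2 ^ (d + j.+1 + 1))%N%:Z.

Definition CR_plus (yx : pair_yx) : set 'Z_(2 ^ e0 * nprime)%N :=
  [set r | exists (d : nat) (t : {ffun 'I_(s_plus yx d) -> bool}),
     (d <= e0)%N /\ r = (mu_plus t)%:~R].

Definition CR_minus (yx : pair_yx) : set 'Z_(2 ^ e0 * nprime)%N :=
  [set r | exists (d : nat) (t : {ffun 'I_(s_minus yx d) -> bool}),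
     (d <= e0)%N /\ r = (mu_minus t)%:~R].

Definition CR : set 'Z_(2 ^ e0 * nprime)%N :=
  (\bigcup_(yx in Sigma_plus) CR_plus yx) `|`
  (\bigcup_(yx in Sigma_minus) CR_minus yx).

End Representatives.

Arguments CR_plus q e0 [s] p e eta yx _.
Arguments CR_minus q e0 [s] p e eta yx _.
Arguments CR q e0 [s] p e eta _.

(* Main.v *)
Require Import Defs.
From mathcomp Require Import all_boot all_order all_algebra.
From mathcomp Require Import all_fingroup cyclic.
From mathcomp Require Import classical_sets zify ring.

(* By the Chinese remainder theorem an integer is treated modulo n' and modulo
   2^e0 separately.  Modulo p_i^e_i it is p_i^y_i times a unit, which is a power
   of eta_i; fixing the coordinates j < i leaves the multiplications by powers of
   q^L, L = lcm_(j < i) f_j, whose subgroup has index g_i gcd(L, f_i) in the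
   cyclic unit group.  Hence the eta^(y,x) represent the q-cosets modulo n', and
   the stabilizer of eta^(y,x) is generated by Q = q^tau.  It remains to describe
   the orbits of Q modulo 2^e0: the exact power 2^d is invariant, and with c = 1
   if Q = 1 mod 4 and c = 2 otherwise, Q^c = 1 + 2^V (2r + 1) with V > 1, so that
   the powers of Q^c are all the residues = 1 mod 2^V.  An orbit of odd residues
   is thus determined by the bits c, ..., min(V, e0 - d) - 1 of its element with
   prescribed residue modulo 2^c. *)

Set Implicit Arguments.
Unset Strict Implicit.
Unset Printing Implicit Defensive.

Import Order.TTheory GRing.Theory Num.Theory.
Local Open Scope classical_set_scope.
Local Open Scope ring_scope.

(** * Cosets in cyclic groups and multiplicative orders *)

(** Both sides are the index in [<[u]>] of the subgroup generated by $u^{kL}$; the left one has the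
    shape of the bound $g_i\gcd(L,f_i)$ in [Sigma]. Dividing [#[u]] and [k] by their gcd leaves
    coprime numbers, so the remaining part of [k] does not affect the gcd with [L]. *)
Lemma index_cycleX (gT : finGroupType) (u : gT) (k L : nat) :
  (#[u]%g %/ #[u ^+ k]%g * gcdn L #[u ^+ k]%g = gcdn (k * L) #[u]%g)%N.
Proof.
rewrite orderXgcd; set f := #[u]%g; set g := gcdn f k.
have f0 : (0 < f)%N by exact: order_gt0.
have g0 : (0 < g)%N by rewrite gcdn_gt0 f0.
have [[f' Ef] [k' Ek]] : (exists f', f = f' * g)%N /\ (exists k', k = k' * g)%N.
  by split; apply/dvdnP; [exact: dvdn_gcdl | exact: dvdn_gcdr].
have f'0 : (0 < f')%N by move: f0; rewrite Ef muln_gt0 => /andP[].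
have co : coprime f' k'.
  by rewrite /coprime -(eqn_pmul2r g0) muln_gcdl -Ef -Ek mul1n.
have Efg : (f %/ g = f')%N by rewrite Ef mulnK.
have Eff : (f %/ f' = g)%N by rewrite Ef mulKn.
rewrite Efg Eff [in RHS]Ef Ek mulnAC -muln_gcdl mulnC; congr (_ * _)%N.
by rewrite [RHS]gcdnC Gauss_gcdr // gcdnC.
Qed.

Lemma cyclic_coset_exists (gT : finGroupType) (u b Q : gT) (L : nat) :
  b \in <[u]>%g -> Q \in <[u]>%g ->
  exists x m, (x < #[u]%g %/ #[Q]%g * gcdn L #[Q]%g)%N /\
              (u ^+ x = b * Q ^+ (L * m))%g.
Proof.
move=> /cycleP[a ->] /cycleP[k ->]; rewrite index_cycleX.
set h := gcdn _ _.
have u0 := order_gt0 u; have h0 : (0 < h)%N by rewrite gcdn_gt0 u0 orbT.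
have [c _ /dvdnP[w Ew]] := Bezoutl (k * L) u0.
rewrite gcdnC -/h in Ew.
(* Bezout gives $ckL\equiv-h$ modulo the order of [u], so this power of [Q] lowers the exponent [a]
   by $h\lfloor a/h\rfloor$. *)
exists (a %% h)%N, (c * (a %/ h))%N; split; first by rewrite ltn_mod.
rewrite -expgM -expgD; apply/eqP; rewrite eq_expg_mod_order eq_sym.
rewrite [X in (X + _)%N](divn_eq a h).
have -> : (a %/ h * h + a %% h + k * (L * (c * (a %/ h))) =
  a %/ h * w * #[u]%g + a %% h)%N by rewrite -mulnA -Ew; lia.
by rewrite modnMDl.
Qed.

(** Since [h] divides both [k * L] and the order of [u], the exponent of [u] modulo [h] is constant
    on each coset of the powers of [Q ^+ L]. *)
Lemma cyclic_coset_unique (gT : finGroupType) (u Q : gT) (L m x x' : nat) :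
  Q \in <[u]>%g ->
  (x < #[u]%g %/ #[Q]%g * gcdn L #[Q]%g)%N ->
  (x' < #[u]%g %/ #[Q]%g * gcdn L #[Q]%g)%N ->
  (u ^+ x' = u ^+ x * Q ^+ (L * m))%g -> x' = x.
Proof.
move=> /cycleP[k ->]; rewrite index_cycleX.
set h := gcdn _ _ => xh x'h.
rewrite -expgM -expgD => /eqP; rewrite eq_expg_mod_order => /eqP E.
have {}E : (x' %% h = (x + k * (L * m)) %% h)%N.
  by rewrite -(modn_dvdm x' (dvdn_gcdr (k * L) #[u]%g)) E modn_dvdm ?dvdn_gcdr.
have /dvdnP[w Ew] : (h %| k * (L * m))%N by rewrite mulnA dvdn_mulr ?dvdn_gcdl.
by move: E; rewrite Ew addnC modnMDl !modn_small.
Qed.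

(** * Congruences of integers and units of ['Z_N] *)

Lemma intr_Zp_eq (N : nat) (a b : int) : (1 < N)%N ->
  (a%:~R == b%:~R :> 'Z_N) = (a == b %[mod N])%Z.
Proof.
move=> N1; rewrite -subr_eq0 -intrB eqz_mod_dvd.
case: (a - b)%R => k.
  by rewrite -pmulrn -(inj_eq val_inj) /= val_Zp_nat.
by rewrite NegzE mulrNz oppr_eq0 -pmulrn -(inj_eq val_inj) /= val_Zp_nat.
Qed.

Lemma intr_Zp_unit (N : nat) (a : int) : (1 < N)%N -> coprimez a N ->
  exists u : {unit 'Z_N}, val u = a%:~R.
Proof.
move=> N1 /coprimezP[[x y] /= E].
have U : (a%:~R : 'Z_N) \is a GRing.unit.
  apply/unitrPr; exists x%:~R; rewrite -intrM -[1]/(1%:~R); apply/eqP.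
  rewrite intr_Zp_eq // eqz_mod_dvd -E; apply/dvdzP; exists (- y); ring.
by exists (FinRing.unit 'Z_N U).
Qed.

Lemma mord_unit (N : nat) (a : int) (u : {unit 'Z_N}) : (1 < N)%N ->
  val u = a%:~R -> mord N a = #[u]%g.
Proof.
move=> N1 Eu; rewrite /mord.
rewrite (@eq_filter _ _ (fun k => #[u]%g %| k)%N); last first.
  move=> k; rewrite -intr_Zp_eq // rmorphXn /= -Eu -FinRing.val_unitX.
  by rewrite -[1%:~R]/(1%R) -FinRing.val_unit1 (inj_eq val_inj) order_dvdn.
have o0 := order_gt0 u.
have oN : (#[u]%g <= N)%N.
  apply: leq_trans (max_card _) _; apply: leq_trans (leq_card _ val_inj) _.
  by rewrite card_ord Zp_cast.
move: (#[u]%g) o0 oN => o o0 oN.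
(* The candidates are split just before [o]: no positive number below [o] is a multiple of it, so
   [o] heads the filtered list. *)
have -> : N = (o.-1 + (N - o).+1)%N by lia.
rewrite iotaD filter_cat; have -> : (1 + o.-1 = o)%N by lia.
rewrite /= dvdnn (@eq_in_filter _ _ pred0) ?filter_pred0 //.
move=> k; rewrite mem_iota => /andP[k1 ko] /=.
by apply/negbTE; apply/negP => /dvdn_leq; lia.
Qed.

Lemma mord1 (a : int) : mord 1 a = 1%N.
Proof. by rewrite /mord /= modz1 modz1. Qed.

Lemma modz_expz1 (m k : nat) (a : int) : (0 < m)%N -> coprimez a m ->
  (a ^+ k == 1 %[mod m])%Z = (mord m a %| k)%N.
Proof.
(* ['Z_1] is not the zero ring, so the modulus 1, which arises when $y_i=e_i$, is treated apart here
   and in the lemmas below. *)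
case: m => [|[|m]] // _ co; first by rewrite mord1 dvd1n !modz1.
have [u Eu] := intr_Zp_unit (isT : 1 < m.+2)%N co.
rewrite (mord_unit _ Eu) // -intr_Zp_eq // rmorphXn /= -Eu.
rewrite -FinRing.val_unitX -[1%:~R]/(1%R) -FinRing.val_unit1.
by rewrite (inj_eq val_inj) order_dvdn.
Qed.

Lemma mord_gt0 (m : nat) (a : int) : (0 < m)%N -> coprimez a m ->
  (0 < mord m a)%N.
Proof.
case: m => [|[|m]] // _ co; first by rewrite mord1.
have [u Eu] := intr_Zp_unit (isT : 1 < m.+2)%N co.
by rewrite (mord_unit _ Eu).
Qed.

(** A positive value is an actual exponent $k$ with $a^k=1+cm$, a Bezout relation for $a^k$ and $m$.
    As totients of positive integers are positive, this makes primitive roots units. *)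
Lemma mord_gt0_coprime (m : nat) (a : int) : (0 < mord m a)%N -> coprimez a m.
Proof.
rewrite /mord; case E: [seq _ <- _ | _] => [|k r] //= _.
have : k \in [seq k <- iota 1 m | (a ^+ k == 1 %[mod m])%Z] by rewrite E inE eqxx.
rewrite mem_filter mem_iota eqz_mod_dvd => /andP[/dvdzP[c Ec] /andP[k0 _]].
rewrite -(coprimez_pexpl a m k0); apply/coprimezP; exists (1, - c) => /=.
by rewrite mulNr -Ec; ring.
Qed.

Lemma primitive_root_coprime (m : nat) (a : int) : (0 < m)%N ->
  primitive_root_mod m a -> coprimez a m.
Proof. by move=> m0 E; apply: mord_gt0_coprime; rewrite E totient_gt0. Qed.

Lemma primitive_root_cycle (m : nat) (a : int) (u v : {unit 'Z_m}) :
  (1 < m)%N -> val u = a%:~R -> primitive_root_mod m a -> v \in <[u]>%g.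
Proof.
move=> m1 Eu; rewrite /primitive_root_mod (mord_unit m1 Eu).
rewrite -card_units_Zp ?(ltnW m1) // => E.
suff -> : <[u]>%g = units_Zp m by rewrite inE.
by apply/eqP; rewrite eqEcard /order in E *; rewrite E leqnn andbT;
   apply/fintype.subsetP=> x _; rewrite inE.
Qed.

(** This is [cyclic_coset_exists] for $bc^{-1}$. In its use, [b] is the unit part of the given
    integer, up to a power of [q], and [c] is the contribution of the other primes. *)
Lemma root_coset_exists (m L : nat) (eta q b c : int) : (0 < m)%N ->
  primitive_root_mod m eta -> coprimez q m -> coprimez b m -> coprimez c m ->
  exists x k, (x < totient m %/ mord m q * gcdn L (mord m q))%N /\
              (eta ^+ x * c = b * q ^+ (L * k) %[mod m])%Z.
Proof.
case: m => [|[|m]] // m0 root coq cob coc.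
  by exists 0%N, 0%N; rewrite mord1 /= gcdn1 !modz1.
have m1 : (1 < m.+2)%N by [].
have [u Eu] := intr_Zp_unit m1 (primitive_root_coprime m0 root).
have [v Ev] := intr_Zp_unit m1 coq.
have [w Ew] := intr_Zp_unit m1 cob.
have [z Ez] := intr_Zp_unit m1 coc.
have inu t : t \in <[u]>%g by apply: primitive_root_cycle root.
have [x [k [xh E]]] := cyclic_coset_exists L (inu (w * z^-1)%g) (inu v).
exists x, k; split; first by rewrite -root (mord_unit m1 Eu) (mord_unit m1 Ev).
apply/eqP; rewrite -intr_Zp_eq // !rmorphM !rmorphXn /= -Eu -Ev -Ew -Ez.
rewrite -!FinRing.val_unitX -!FinRing.val_unitM; apply/eqP; congr val.
have zt : (v ^+ (L * k) * z = z * v ^+ (L * k))%g.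
  by apply/val_inj; rewrite !FinRing.val_unitM mulrC.
by rewrite E -!mulgA zt mulKg.
Qed.

Lemma root_coset_unique (m L k x x' : nat) (eta q : int) : (0 < m)%N ->
  primitive_root_mod m eta -> coprimez q m ->
  (x < totient m %/ mord m q * gcdn L (mord m q))%N ->
  (x' < totient m %/ mord m q * gcdn L (mord m q))%N ->
  (eta ^+ x' = eta ^+ x * q ^+ (L * k) %[mod m])%Z -> x' = x.
Proof.
case: m => [|[|m]] // m0 root coq.
  by rewrite mord1 gcdn1 /=; case: x x' => [|x] [].
have m1 : (1 < m.+2)%N by [].
have [u Eu] := intr_Zp_unit m1 (primitive_root_coprime m0 root).
have [v Ev] := intr_Zp_unit m1 coq.
rewrite -root (mord_unit m1 Eu) (mord_unit m1 Ev) => xh x'h /eqP.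
rewrite -intr_Zp_eq // !rmorphM !rmorphXn /= -Eu -Ev.
rewrite -!FinRing.val_unitX -!FinRing.val_unitM (inj_eq val_inj) => /eqP E.
by apply: cyclic_coset_unique xh x'h E; apply: primitive_root_cycle root.
Qed.

(** * Cyclotomic cosets modulo n' *)

Lemma modz_cancel (m a b c : int) : coprimez c m ->
  (a * c = b * c %[mod m])%Z -> (a = b %[mod m])%Z.
Proof.
move=> co /eqP; rewrite eqz_mod_dvd -mulrBl Gauss_dvdzl 1?coprimez_sym //.
by rewrite -eqz_mod_dvd => /eqP.
Qed.

Lemma modz_mull2 (m a b c : int) :
  (a = b %[mod m])%Z -> (c * a = c * b %[mod m])%Z.
Proof. by move=> E; rewrite -modzMmr E modzMmr. Qed.

Lemma modz_mulr2 (m a b c : int) :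
  (a = b %[mod m])%Z -> (a * c = b * c %[mod m])%Z.
Proof. by move=> E; rewrite -modzMml E modzMml. Qed.

Lemma PoszX (p k : nat) : (p ^ k)%N%:Z = p%:Z ^+ k.
Proof. by elim: k => // k IH; rewrite expnS PoszM IH exprS. Qed.

Lemma gcdz_expn_mull (p y e : nat) (b : int) : (y <= e)%N ->
  gcdz (p%:Z ^+ y * b) (p ^ e)%N = p%:Z ^+ y * gcdz b (p ^ (e - y))%N.
Proof.
by move=> ye; rewrite -{1}(subnKC ye) expnD PoszM -PoszX -mulz_gcdr absz_nat.
Qed.

Lemma modz_expn_mul2l (p y e : nat) (a b : int) : (0 < p)%N -> (y <= e)%N ->
  (p%:Z ^+ y * a == p%:Z ^+ y * b %[mod (p ^ e)%N])%Z =
  (a == b %[mod (p ^ (e - y))%N])%Z.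
Proof.
move=> p0 ye; rewrite !eqz_mod_dvd -mulrBr -{1}(subnKC ye) expnD PoszM.
rewrite PoszX.
by rewrite dvdz_mul2l // expf_neq0 //; lia.
Qed.

Lemma coprime_prodr (I : Type) (r : seq I) (P : pred I) (F : I -> nat) m :
  (forall i, P i -> coprime m (F i)) -> coprime m (\prod_(i <- r | P i) F i)%N.
Proof.
move=> H; apply: (big_ind (coprime m)) => //; first exact: coprimen1.
by move=> a b; rewrite coprimeMr => -> ->.
Qed.

Lemma Gauss_dvd_prod (I : eqType) (r : seq I) (F : I -> nat) n : uniq r ->
  (forall i j, i != j -> coprime (F i) (F j)) ->
  (\prod_(i <- r) F i %| n)%N = all (fun i => F i %| n)%N r.
Proof.
move=> + co; elim: r => [|i r IH]; first by rewrite big_nil dvd1n.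
move=> /= /andP[ir ur]; rewrite big_cons Gauss_dvd ?IH // big_seq.
by apply: coprime_prodr => j jr; apply: co; apply: contraNneq ir => ->.
Qed.

Section OddPart.

Context (q s : nat) (p e : 'I_s -> nat) (eta : 'I_s -> int).
Context (p_prime : forall i, prime (p i)) (p_inj : injective p).
Context (q_coprime : forall i, coprime q (p i)).
Context (eta_prs : primitive_root_system p e eta).

Let P i := (p i ^ e i)%N.

Lemma p_exp_gt0 i k : (0 < p i ^ k)%N.
Proof. by rewrite expn_gt0 prime_gt0. Qed.

Lemma coprime_q i k j : coprimez (q%:Z ^+ j) (p i ^ k)%N.
Proof. by apply: coprimezXl; rewrite coprimezE /= coprimeXr. Qed.

Lemma coprime_p i j k l : j != i -> coprime (p j ^ k) (p i ^ l)%N.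
Proof.
move=> ji; apply/coprimeXl/coprimeXr; rewrite prime_coprime // dvdn_prime2 //.
by apply: contraNneq ji => /p_inj ->.
Qed.

Lemma eta_primitive_root i d : primitive_root_mod (p i ^ d)%N (eta i).
Proof.
by case: d => [|d]; [exact: mord1 | have [H _] := eta_prs i; exact: H].
Qed.

Lemma coprime_eta i d k : coprimez (eta i ^+ k) (p i ^ d)%N.
Proof.
apply/coprimezXl/primitive_root_coprime; first exact: p_exp_gt0.
exact: eta_primitive_root.
Qed.

Definition cofactor (y : 'I_s -> nat) (i : 'I_s) : int :=
  \prod_(j < s | j != i) (p j)%:Z ^+ y j.

Lemma cofactor_coprime y i d : coprimez (cofactor y i) (p i ^ d)%N.
Proof.
rewrite coprimezE /cofactor; apply: (big_ind (fun a : int => coprime `|a| _)).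
- exact: coprime1n.
- by move=> a b; rewrite abszM coprimeMl => -> ->.
- by move=> j ji; rewrite abszX; exact: coprime_p.
Qed.

(** The other $\eta_j$ are 1 modulo $p_i^{e_i}$, so only their companions $p_j^{y_j}$ survive; these
    form the unit [cofactor], which depends on [y] alone. *)
Lemma eta_pow_mod (yx : pair_yx s) i :
  (eta_pow p eta yx =
   (p i)%:Z ^+ yx.1 i * (eta i ^+ yx.2 i * cofactor yx.1 i) %[mod P i])%Z.
Proof.
rewrite /eta_pow (bigD1 i) //= [X in _ * X](bigD1 i) //= -/(cofactor _ _).
set E := \prod_(j < s | j != i) _.
have E1 : (E = 1 %[mod P i])%Z.
  rewrite /E; apply: (big_ind (fun a : int => (a = 1 %[mod P i])%Z)) => //.
    by move=> a b Ea Eb; rewrite -modzMm Ea Eb modzMm mulr1.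
  move=> j ji; rewrite -modzXm; have [_ ->] := eta_prs j.
    by rewrite modzXm expr1n.
  by rewrite eq_sym.
rewrite [X in (X %% _)%Z](_ : _ = E * ((p i)%:Z ^+ yx.1 i *
  (eta i ^+ yx.2 i * cofactor yx.1 i))); last by ring.
by rewrite (modz_mulr2 _ E1) mul1r.
Qed.

Lemma nprime_modP (a b : int) :
  reflect (forall i, (a = b %[mod P i])%Z) (a == b %[mod nprime p e])%Z.
Proof.
rewrite eqz_mod_dvd dvdzE /= /nprime Gauss_dvd_prod ?index_enum_uniq //.
  apply: (iffP allP) => H i; last first.
    by move=> _; have /eqP := H i; rewrite eqz_mod_dvd dvdzE.
  by apply/eqP; rewrite eqz_mod_dvd dvdzE /=; apply: H; rewrite mem_index_enum.
by move=> i j; exact: coprime_p.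
Qed.

Lemma eta_pow_modE (yx : pair_yx s) i (a : int) : (yx.1 i <= e i)%N ->
  (eta_pow p eta yx == (p i)%:Z ^+ yx.1 i * a %[mod P i])%Z =
  (eta i ^+ yx.2 i * cofactor yx.1 i == a %[mod (p i ^ (e i - yx.1 i))%N])%Z.
Proof. by move=> ye; rewrite eta_pow_mod modz_expn_mul2l ?prime_gt0. Qed.

Lemma eta_pow_gcd (yx : pair_yx s) i : (yx.1 i <= e i)%N ->
  gcdz (eta_pow p eta yx) (P i) = (p i)%:Z ^+ yx.1 i.
Proof.
move=> ye; rewrite -gcdz_modl eta_pow_mod gcdz_modl gcdz_expn_mull //.
rewrite (eqP (_ : coprimez _ _)) ?mulr1 //.
by rewrite coprimezMl coprime_eta cofactor_coprime.
Qed.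

Lemma modz_q_mord i yi j : (f_ q p e i yi %| j)%N =
  (q%:Z ^+ j == 1 %[mod (p i ^ (e i - yi))%N])%Z.
Proof.
by rewrite modz_expz1 ?p_exp_gt0 // -[q%:Z]expr1 coprime_q.
Qed.

(** Because of the factor $p_i^{y_i}$, it is enough that $q^j$ be 1 modulo $p_i^{e_i-y_i}$, where
    the order of $q$ is $f_{i,y_i}$. *)
Lemma eta_pow_tau (yx : pair_yx s) j : Sigma q p e yx ->
  (tau q p e yx %| j)%N ->
  (eta_pow p eta yx * q%:Z ^+ j = eta_pow p eta yx %[mod nprime p e])%Z.
Proof.
move=> yxS tj; apply/eqP/nprime_modP => i; have [ye _] := yxS i.
rewrite (modz_mulr2 _ (eta_pow_mod yx i)) [RHS]eta_pow_mod -mulrA; apply/eqP.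
rewrite modz_expn_mul2l ?prime_gt0 // -[X in (_ == X %[mod _])%Z]mulr1.
apply/eqP/modz_mull2/eqP; rewrite -modz_q_mord.
by apply: dvdn_trans tj; apply: (biglcmn_sup i).
Qed.

(** Multiplication by $q^j$ keeps the gcd with $p_i^{e_i}$, which determines [y]; the [x i] follow
    one index at a time. The divisibility by [tau] bounds the stabilizer, which is what acts modulo
    $2^{e_0}$ later. *)
Lemma eta_pow_unique (yx yx' : pair_yx s) j :
  Sigma q p e yx -> Sigma q p e yx' ->
  (eta_pow p eta yx' = eta_pow p eta yx * q%:Z ^+ j %[mod nprime p e])%Z ->
  yx' = yx /\ (tau q p e yx %| j)%N.
Proof.
case: yx yx' => [y x] [y' x'] yxS yxS' /eqP/nprime_modP E.
have Ey : y' = y.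
  apply/ffunP => i; have [ye _] := yxS i; have [ye' _] := yxS' i.
  have := eta_pow_gcd ye'; rewrite -gcdz_modl E gcdz_modl gcdzC.
  rewrite Gauss_gcdzl; last by rewrite coprimez_sym; exact: coprime_q.
  rewrite gcdzC eta_pow_gcd //= -!PoszX => -[] /expnI -> //.
  exact: prime_gt1.
rewrite {}Ey in yxS' E *.
have step i : (eta i ^+ x' i = eta i ^+ x i * q%:Z ^+ j
    %[mod (p i ^ (e i - y i))%N])%Z.
  have [/= ye _] := yxS i.
  apply: (modz_cancel (cofactor_coprime y i _)); rewrite mulrAC; apply/eqP.
  rewrite -(@eta_pow_modE (y, x')) // E.
  by rewrite (modz_mulr2 _ (eta_pow_mod _ i)) -mulrA.
(* Once the orders of all smaller indices divide [j], so does their lcm $L$, and $q^j$ is a power of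
   $q^L$, as uniqueness of $x_i$ requires. Cancelling $\eta_i^{x_i}$ then gives $f_{i,y_i}\mid j$
   for the next index. *)
have {step} main k (i : 'I_s) : (i < k)%N ->
    x' i = x i /\ (f_ q p e i (y i) %| j)%N.
  elim: k i => // k IH i; rewrite ltnS => ik.
  have /dvdnP[m Em] : (\big[lcmn/1]_(l < s | (l < i)%N) f_ q p e l (y l) %| j)%N.
    by apply/dvdn_biglcmP => l li; have [] := IH l (leq_trans li ik).
  have [_ xi] := yxS i; have [_ xi'] := yxS' i.
  rewrite mulnC in Em.
  have Ex : x' i = x i.
    have := step i; rewrite {1}Em; apply: root_coset_unique => //.
    - exact: p_exp_gt0.
    - exact: eta_primitive_root.
    - by rewrite -[q%:Z]expr1 coprime_q.
  split=> //; rewrite modz_q_mord; apply/eqP; have := step i; rewrite Ex.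
  rewrite -{1}[eta i ^+ x i]mulr1 ![eta i ^+ _ * _]mulrC => /modz_cancel -> //.
  exact: coprime_eta.
split; last by apply/dvdn_biglcmP => i _; have [] := main i.+1 i (ltnSn i).
by congr (_, _); apply/ffunP => i; have [] := main i.+1 i (ltnSn i).
Qed.

Lemma eta_pow_exists (gamma : int) : exists yx j, Sigma q p e yx /\
  (eta_pow p eta yx = gamma * q%:Z ^+ j %[mod nprime p e])%Z.
Proof.
(* The valuation of [gamma] at [p i] is cut off at [e i]; at the cutoff the remaining modulus is 1
   and the coprimality is vacuous, so [gamma] may be 0. *)
have : forall i, exists yb : nat * int, [/\ (yb.1 <= e i)%N,
    gamma = (p i)%:Z ^+ yb.1 * yb.2 & coprimez yb.2 (p i ^ (e i - yb.1))%N].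
  move=> i; have /(dvdn_pfactor _ _ (p_prime i))[y ye Ey] :
    (`|gcdz gamma (P i)| %| p i ^ e i)%N by exact: dvdz_gcdr.
  have g0 : gcdz gamma (P i) = (p i)%:Z ^+ y.
    by rewrite -PoszX -Ey.
  have /dvdzP[b Eb] := dvdz_gcdl gamma (P i); rewrite g0 mulrC in Eb.
  exists (y, b); split=> //.
  move: g0; rewrite Eb gcdz_expn_mull // -[RHS]mulr1 => /mulfI H.
  by apply/eqP/H; rewrite expf_neq0 //; have := prime_gt0 (p_prime i); lia.
case/fin_all_exists => yb /all_and3[ye Eg cob].
set y := fun i => (yb i).1; set b := fun i => (yb i).2.
have main k : (k <= s)%N ->
    exists (x : 'I_s -> nat) j, forall i : 'I_s, (i < k)%N ->
    (x i < g_ q p e i (y i) * gcdn (\big[lcmn/1]_(l < s | (l < i)%N)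
        f_ q p e l (y l)) (f_ q p e i (y i)))%N /\
    (eta i ^+ x i * cofactor y i = b i * q%:Z ^+ j
       %[mod (p i ^ (e i - y i))%N])%Z.
  elim: k => [_|k IH ks]; first by exists (fun=> 0%N), 0%N.
  have [x [j H]] := IH (ltnW ks).
  set i0 : 'I_s := Ordinal ks.
  set L := (\big[lcmn/1]_(l < s | (l < i0)%N) f_ q p e l (y l))%N.
  have [|||||x0 [m [x0lt E0]]] := @root_coset_exists (p i0 ^ (e i0 - y i0))%N L
    (eta i0) q (b i0 * q%:Z ^+ j) (cofactor y i0).
  - exact: p_exp_gt0.
  - exact: eta_primitive_root.
  - by rewrite -[q%:Z]expr1 coprime_q.
  - by rewrite coprimezMl coprime_q andbT; exact: cob.
  - exact: cofactor_coprime.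
  (* Raising [j] by a multiple of [L] preserves the congruences at smaller indices, whose orders
     divide [L]. *)
  exists (fun i => if i == i0 then x0 else x i), (j + L * m)%N => i.
  rewrite ltnS leq_eqVlt; case: (i =P i0) => [-> _|ni /orP[/eqP ik|ik]].
  - by split; rewrite // exprD mulrA.
  - by case: ni; apply: val_inj.
  have [xlt E] := H i ik; split=> //.
  rewrite exprD mulrA E -[X in (X %% _)%Z = _]mulr1; apply/esym/modz_mull2/eqP.
  by rewrite -modz_q_mord dvdn_mulr // (biglcmn_sup i).
have [x [j H]] := main s (leqnn s).
exists ([ffun i => y i], [ffun i => x i]), j; split.
  move=> i /=; rewrite !ffunE; split; first exact: ye.
  have [+ _] := H i (ltn_ord i).
  by under [in X in _ -> X]eq_bigr do rewrite ffunE.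
apply/eqP/nprime_modP => i; have [_ E] := H i (ltn_ord i).
apply/eqP; rewrite {1}(Eg i) -mulrA.
have -> : (yb i).1 = ([ffun i => y i] : {ffun 'I_s -> nat}) i by rewrite ffunE.
rewrite eta_pow_modE /= !ffunE; last exact: ye.
by rewrite -E /cofactor; under [in X in X == _]eq_bigr do rewrite ffunE.
Qed.

End OddPart.

(** * Orbits modulo powers of two *)

Lemma even_intM (a b : int) :
  (2 %| a * b)%Z = (2 %| a)%Z || (2 %| b)%Z.
Proof. by rewrite !dvdzE abszM /= Euclid_dvdM. Qed.

Lemma odd_intX (a : int) k : ~~ (2 %| a)%Z -> ~~ (2 %| a ^+ k)%Z.
Proof. by move=> a2; elim: k => // k IH; rewrite exprS even_intM negb_or a2. Qed.

Lemma odd_int_coprime (a : int) k : ~~ (2 %| a)%Z -> coprimez a (2 ^ k)%N.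
Proof.
by move=> a2; rewrite coprimezE /= coprime_sym coprimeXl // prime_coprime // -dvdzE.
Qed.

(** By $(1+2^Vt)^2=1+2^{V+1}(t+2^{V-1}t^2)$, each squaring raises the valuation of $Q-1$ by exactly
    one: $V>1$ keeps the last factor odd when $t$ is. *)
Lemma expr_2adic (V i : nat) (r : int) : (1 < V)%N -> exists r',
  (1 + 2 ^+ V * (2 * r + 1)) ^+ (2 ^ i) = 1 + 2 ^+ (V + i) * (2 * r' + 1).
Proof.
case: V => [|[|V]] // _; elim: i => [|i [r' E]].
  by exists r; rewrite addn0 expr1.
exists (r' + 2 ^+ (V + i) * (2 * r' + 1) ^+ 2).
rewrite expnSr exprM E addnS !addSn !exprS; ring.
Qed.

(** Induction on [M]: a power that is right modulo $2^M$ but not modulo $2^{M+1}$ is corrected by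
    the factor $Q^{2^{M-V}}$, which is 1 plus an odd multiple of $2^M$. *)
Lemma orbit_2adic (V M : nat) (r a b : int) : (1 < V)%N -> ~~ (2 %| a)%Z ->
  (b = a %[mod (2 ^ V)%N])%Z -> exists k,
  (b = a * (1 + 2 ^+ V * (2 * r + 1)) ^+ k %[mod (2 ^ M)%N])%Z.
Proof.
move=> V1 a2; set Q := 1 + _ => ab.
have Q2 : ~~ (2 %| Q)%Z.
  by rewrite /Q; case: (V) V1 => // n _; rewrite exprS -mulrA; lia.
elim: M => [|M [k IH]]; first by exists 0%N; rewrite !modz1.
have [MV|VM] := leqP M.+1 V.
  exists 0%N; rewrite mulr1; apply/eqP; rewrite eqz_mod_dvd.
  move/eqP: ab; rewrite eqz_mod_dvd; apply: dvdz_trans.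
  by rewrite dvdzE /= dvdn_exp2l.
move/eqP: IH; rewrite eqz_mod_dvd PoszX => /dvdzP[c Ec].
have [c2|c2] := boolP (2 %| c)%Z.
  exists k; apply/eqP; rewrite eqz_mod_dvd PoszX exprS Ec.
  by rewrite dvdz_mul2r // expf_neq0.
have [r' Er] := expr_2adic (M - V) r V1; rewrite subnKC // -/Q in Er.
exists (k + 2 ^ (M - V))%N; apply/eqP; rewrite eqz_mod_dvd PoszX exprS.
have -> : b - a * Q ^+ (k + 2 ^ (M - V)) =
    (c - a * Q ^+ k * (2 * r' + 1)) * 2 ^+ M.
  by rewrite exprD Er mulrBl -Ec; ring.
rewrite dvdz_mul2r ?expf_neq0 //.
have : ~~ (2 %| a * Q ^+ k * (2 * r' + 1))%Z.
  by rewrite !even_intM !negb_or a2 odd_intX //=; lia.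
lia.
Qed.

(** Given the residue modulo $2^c$, an orbit of odd numbers is determined by the bits from [c] up to
    the smaller of [V] and [M]; as [m] is odd, [w] can prescribe them. If $M\le c$, no bit is free
    and [w] is 0. *)
Lemma rep_2adic_exists (c V M m : nat) (r u g : int) :
  (1 < V)%N -> (c <= V)%N -> odd m ->
  ((c < M)%N -> ~~ (2 %| g)%Z) -> (u = g %[mod (2 ^ minn c M)%N])%Z ->
  exists w k, (w < 2 ^ minn (M - c) (V - c))%N /\
    (u + m%:Z * (2 ^ c * w)%N%:Z =
      g * (1 + 2 ^+ V * (2 * r + 1)) ^+ k %[mod (2 ^ M)%N])%Z.
Proof.
move=> V1 cV om; have [Mc _ ug|cM /(_ isT) g2 ug] := leqP M c.
  by exists 0%N, 0%N; rewrite expn_gt0 muln0 mulr0 addr0 mulr1.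
set s := minn _ _.
move/eqP: ug; rewrite eqz_mod_dvd => /dvdzP[h Eh].
have m2 : ~~ (2 %| m%:Z)%Z by lia.
(* [x] inverts [m] modulo $2^s$, so the residue of $-hx$ solves $h+mw\equiv0$. *)
have /coprimezP[[x y] /= Exy] := odd_int_coprime s m2.
have p0 : (2 ^ s)%N%:Z != 0 by rewrite PoszX expf_neq0.
have /gez0_abs Ew := modz_ge0 (- h * x) p0.
set w := `|((- h * x) %% (2 ^ s)%N)%Z|%N in Ew.
have ws : (w < 2 ^ s)%N by rewrite -ltz_nat Ew ltz_pmod //; lia.
have hw : ((2 ^ s)%N %| h + m%:Z * w%:Z)%Z.
  have := divz_eq (- h * x) (2 ^ s)%N; rewrite -Ew; set t := (_ %/ _)%Z => Et.
  apply/dvdzP; exists (h * y - m%:Z * t).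
  have -> : w%:Z = - h * x - t * (2 ^ s)%N by rewrite Et; ring.
  have Eh1 : h = h * (x * m%:Z + y * (2 ^ s)%N) by rewrite Exy mulr1.
  by rewrite {1}Eh1; ring.
set z := u + m%:Z * (2 ^ c * w)%N%:Z.
have zg : (z = g %[mod (2 ^ (c + s))%N])%Z.
  apply/eqP; rewrite eqz_mod_dvd expnD PoszM.
  have -> : z - g = (2 ^ c)%N%:Z * (h + m%:Z * w%:Z).
    by rewrite /z PoszM addrAC Eh; ring.
  by rewrite dvdz_mul2l // PoszX expf_neq0.
(* If $V\le M$, agreement modulo $2^{c+s}=2^V$ suffices by [orbit_2adic]; otherwise $c+s=M$ and the
   exponent 0 works. *)
have [VM|MV] := leqP V M.
  have [k Ek] : exists k,
      (z = g * (1 + 2 ^+ V * (2 * r + 1)) ^+ k %[mod (2 ^ M)%N])%Z.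
    apply: orbit_2adic => //.
    by have <- : (c + s = V)%N by rewrite /s; lia.
  by exists w, k.
exists w, 0%N; split=> //; rewrite mulr1.
by have <- : (c + s = M)%N by rewrite /s; lia.
Qed.

(** A power of [Q] is 1 modulo $2^V$, so it leaves residues modulo $2^{c+s}$ unchanged, and [w] is
    recovered modulo $2^s$ by cancelling the odd [m]. *)
Lemma rep_2adic_unique (c V M m k w w' : nat) (Q u : int) : odd m ->
  ((2 ^ V)%N %| Q - 1)%Z ->
  (w < 2 ^ minn (M - c) (V - c))%N -> (w' < 2 ^ minn (M - c) (V - c))%N ->
  (u + m%:Z * (2 ^ c * w')%N%:Z =
    (u + m%:Z * (2 ^ c * w)%N%:Z) * Q ^+ k %[mod (2 ^ M)%N])%Z -> w' = w.
Proof.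
move=> om; have m2 : ~~ (2 %| m%:Z)%Z by lia.
move=> QV; set s := minn _ _ => ws w's /eqP.
rewrite eqz_mod_dvd => H.
have [s0|s0] := posnP s; first by rewrite s0 in ws w's; lia.
have [sM sV] : (c + s <= M)%N /\ (c + s <= V)%N by rewrite /s; lia.
have cs : ((2 ^ (c + s))%N %| (2 ^ V)%N%:Z)%Z && ((2 ^ (c + s))%N %| (2 ^ M)%N%:Z)%Z.
  by rewrite !dvdzE /= !dvdn_exp2l.
have Qk : (Q ^+ k = 1 %[mod (2 ^ V)%N])%Z.
  rewrite -modzXm (_ : (Q %% _)%Z = (1 %% (2 ^ V)%N)%Z) ?modzXm ?expr1n //.
  by apply/eqP; rewrite eqz_mod_dvd.
move/eqP: Qk; rewrite eqz_mod_dvd => Qk.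
case/andP: cs => /dvdz_trans/(_ Qk) d1 /dvdz_trans/(_ H) d2.
have : ((2 ^ (c + s))%N %| m%:Z * (2 ^ c)%N%:Z * (w'%:Z - w%:Z))%Z.
  have -> : m%:Z * (2 ^ c)%N%:Z * (w'%:Z - w%:Z) =
    (u + m%:Z * (2 ^ c * w')%N%:Z - (u + m%:Z * (2 ^ c * w)%N%:Z) * Q ^+ k) +
    (u + m%:Z * (2 ^ c * w)%N%:Z) * (Q ^+ k - 1) by rewrite !PoszM; ring.
  by apply: rpredD => //; apply: dvdz_mull.
rewrite expnD PoszM [m%:Z * _]mulrC -mulrA dvdz_mul2l ?PoszX ?expf_neq0 //.
rewrite -PoszX mulrC Gauss_dvdzl; last first.
  by rewrite coprimez_sym odd_int_coprime.
rewrite -eqz_mod_dvd !modz_small; first by move/eqP => -[].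
  by rewrite /= ltz_nat.
by rewrite /= ltz_nat.
Qed.

(** The first [d] digits force divisibility by $2^d$; the complemented digit at position [d] then
    prevents divisibility by $2^{d+1}$. *)
Lemma U_spec (m d : nat) (a : int) : odd m -> exists u,
  ~~ (2 %| u)%Z /\ a + m%:Z * (U_ m d a)%:Z = 2 ^+ d * u.
Proof.
move=> om; rewrite /U_ -digit_sumE.
have H : ((2 ^ d)%N %| a + m%:Z * (digit_sum m a d)%:Z)%Z.
  case: d => [|d]; first exact: dvd1z.
  by rewrite digit_sumE; apply: digit_spec.
have -> : (1 - digit m a d = ~~ digit m a d)%N by case: (digit _ _ _).
have := dvdz_next_digit (~~ digit m a d) om H.
rewrite -/(digit m a d) [RHS](_ : _ = false); last by case: (digit _ _ _).
have /dvdzP[u ->] : ((2 ^ d)%N %|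
    a + m%:Z * (digit_sum m a d + ~~ digit m a d * 2 ^ d)%N%:Z)%Z.
  by rewrite PoszD mulrDr addrA; apply: rpredD => //; rewrite PoszM mulrA dvdz_mull.
rewrite expnS PoszM dvdz_mul2r ?PoszX ?expf_neq0 // => u2.
by exists u; rewrite u2 mulrC.
Qed.

Lemma bits_lt n (t : 'I_n -> bool) : (\sum_(j < n) t j * 2 ^ j < 2 ^ n)%N.
Proof.
elim: n t => [|n IH] t; first by rewrite big_ord0.
rewrite big_ord_recr /= expnS; have := IH (fun j => t (widen_ord (leqnSn n) j)).
move: (bigop _ _ _) (2 ^ n)%N => S P; case: (t ord_max); lia.
Qed.

Lemma bits_exists n w : (w < 2 ^ n)%N ->
  exists t : {ffun 'I_n -> bool}, (\sum_(j < n) t j * 2 ^ j)%N = w.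
Proof.
elim: n w => [|n IH] w; first by exists [ffun=> false]; rewrite big_ord0; lia.
rewrite expnS => wn; have [|t Et] := IH w./2; first by lia.
exists [ffun j => if unlift ord0 j is Some i then t i else odd w].
rewrite big_ord_recl ffunE unlift_none expn0 muln1 -[RHS]odd_double_half -Et.
congr (_ + _)%N; rewrite -muln2 big_distrl /=; apply: eq_bigr => i _.
by rewrite ffunE liftK /= /bump /= add1n expnS; lia.
Qed.

(** The valuation is truncated at [n], so that $g=0$ and multiples of $2^n$ need no separate
    case. *)
Lemma odd_part_trunc_exists (n : nat) (g : int) : exists d g',
  [/\ (d <= n)%N, g = 2 ^+ d * g' & (d < n)%N -> ~~ (2 %| g')%Z].
Proof.
elim: n => [|n [d [g' [dn Eg odd_g']]]]; first by exists 0%N, g; rewrite mul1r.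
have [dltn|dgen] := ltnP d n; first by exists d, g'; split=> //; lia.
have [/dvdzP[h Eh]|g2] := boolP (2 %| g')%Z; last by exists d, g'; split=> //; lia.
by exists d.+1, h; split; [lia | rewrite Eg Eh exprSr; ring | lia].
Qed.

(** * Representatives modulo $2^{e_0}$ for a fixed pair $(y,x)$ *)

Section Representatives.

Context (q e0 s : nat) (p e : 'I_s -> nat) (eta : 'I_s -> int).
Context (p_prime : forall i, prime (p i)) (q_coprime : forall i, coprime q (p i)).
Context (p_odd : forall i, odd (p i)) (q_odd : odd q) (q_gt1 : (1 < q)%N).

Lemma nprime_odd : odd (nprime p e).
Proof.
rewrite /nprime; apply: (big_ind odd) => //; last first.
  by move=> i _; rewrite oddX p_odd orbT.
by move=> a b; rewrite oddM => -> ->.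
Qed.

Lemma tau_gt0 yx : (0 < tau q p e yx)%N.
Proof.
rewrite /tau; apply: (big_ind (fun n => 0 < n)%N) => //.
  by move=> a b; rewrite lcmn_gt0 => -> ->.
move=> i _; apply: mord_gt0; first exact: p_exp_gt0.
by rewrite -[q%:Z]expr1 coprime_q.
Qed.

(* The exponent c of the header: the two cases of the theorem differ only in the
   position d + c of the lowest free bit of a representative. *)
Definition shift (yx : pair_yx s) : nat :=
  if (q ^ tau q p e yx %% 4 == 1)%N then 1 else 2.

Definition width (yx : pair_yx s) (d : nat) : nat :=
  if (q ^ tau q p e yx %% 4 == 1)%N then s_plus q e0 p e yx d
  else s_minus q e0 p e yx d.

(** Common form of [mu_plus] and [mu_minus], with the bit tuple [t] read as the binary expansion of
    [w]. *)
Definition rep (yx : pair_yx s) (d w : nat) : int :=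
  eta_pow p eta yx + (nprime p e)%:Z *
    (U_ (nprime p e) d (eta_pow p eta yx) + 2 ^ (d + shift yx) * w)%N%:Z.

(** All that the rest needs from the two cases modulo 4. The last two clauses say that [Q] generates
    the odd residues modulo $2^c$, a group of order $c$, where $c$ is [shift yx]. *)
Lemma shift_spec yx (Q := q%:Z ^+ tau q p e yx) : exists V r,
  [/\ (1 < V)%N /\ (shift yx <= V)%N,
      forall d, width yx d = minn (e0 - d - shift yx) (V - shift yx),
      Q ^+ shift yx = 1 + 2 ^+ V * (2 * r + 1),
      forall k, (Q ^+ k = 1 %[mod (2 ^ shift yx)%N])%Z -> (shift yx %| k)%N
    & forall u g, ~~ (2 %| u)%Z -> ~~ (2 %| g)%Z ->
      exists k, (u = g * Q ^+ k %[mod (2 ^ shift yx)%N])%Z].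
Proof.
rewrite /shift /width /s_plus /s_minus /v_plus /v_minus.
have EQ : Q = (q ^ tau q p e yx)%N by rewrite PoszX.
have : odd (q ^ tau q p e yx) by rewrite oddX q_odd orbT.
have : (1 < q ^ tau q p e yx)%N by
  rewrite -(exp1n (tau q p e yx)) ltn_exp2r ?tau_gt0.
move: (q ^ _)%N Q EQ => n Q -> {Q} n1 on.
case: eqP => n4.
  have n0 : (0 < n - 1)%N by lia.
  have [m m2 Em] := pfactor_coprime (isT : prime 2) n0.
  have v2 : (1 < logn 2 (n - 1))%N by rewrite -pfactor_dvdn //; lia.
  move: (logn _ _) Em v2 => v Em v2.
  exists v, (m./2)%:Z; split=> //.
  - by split=> //; lia.
  - have -> : 2 * m./2%:Z + 1 = m by move: m2; rewrite coprime2n; lia.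
    have := congr1 Posz Em; rewrite PoszM PoszX => E.
    by rewrite expr1 mulrC -E; lia.
  - by move=> u g u2 g2; exists 0%N; rewrite mulr1; lia.
have n0 : (0 < n + 1)%N by lia.
have [m m2 Em] := pfactor_coprime (isT : prime 2) n0.
have v2 : (1 < logn 2 (n + 1))%N by rewrite -pfactor_dvdn //; lia.
move: (logn _ _) Em v2 => [|[|v]] // Em v2.
have [a Ea] : exists a : int, m%:Z = 2 * a + 1.
  by exists (m./2)%:Z; move: m2; rewrite coprime2n; lia.
(* Here [v_minus] is [v.+2], and $(2^{v+2}m-1)^2=1+2^{v+3}(2^{v+1}m^2-m)$. Thus $V$ is [v_minus]
   plus 1, and $V-2$ is the bound in [s_minus]. *)
exists v.+3, (2 ^+ v * (2 * a + 1) ^+ 2 - a - 1); split=> //.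
- have := congr1 Posz Em; rewrite PoszM PoszX PoszD Ea => E.
  have -> : n%:Z = (2 * a + 1) * 2 ^+ v.+2 - 1 by rewrite -E; ring.
  by rewrite !exprS; ring.
- move=> k; rewrite dvdn2; have [k_odd|//] := boolP (odd k).
  have n4' : (n%:Z ^+ 2 = 1 %[mod 4])%Z.
    have -> : n%:Z = 4 * (n %/ 4)%N%:Z + 3 by lia.
    by rewrite expr2; lia.
  rewrite -[k]odd_double_half k_odd exprD -muln2 mulnC exprM expr1.
  by rewrite -modzMmr -[X in (_ * X)%R]modzXm n4' modzXm expr1n modzMmr mulr1; lia.
- move=> u g u2 g2.
  have [E|E] : (u = g %[mod 4])%Z \/ (u = g * 3 %[mod 4])%Z by lia.
    by exists 0%N; rewrite mulr1.
  exists 1%N; rewrite E; apply: modz_mull2; rewrite expr1 /=; lia.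
Qed.

(** By [U_spec] the valuation is exactly [d]; one [u] serves all [w], which therefore affects the
    odd part only from bit [shift yx] on. *)
Lemma rep_factor (yx : pair_yx s) d : exists u, ~~ (2 %| u)%Z /\ forall w,
  rep yx d w = 2 ^+ d * (u + (nprime p e)%:Z * (2 ^ shift yx * w)%N%:Z).
Proof.
have [u [u2 Eu]] := U_spec d (eta_pow p eta yx) nprime_odd.
exists u; split=> // w; rewrite /rep PoszD mulrDr addrA Eu mulrDr expnD -mulnA.
by rewrite [(2 ^ d * _)%N%:Z]PoszM PoszX; ring.
Qed.

Lemma shift_gt0 yx : (0 < shift yx)%N.
Proof. by rewrite /shift; case: ifP. Qed.

(** After $2^d$ is split off, a power [k0] of [Q] first aligns the odd parts modulo $2^c$, with $c$
    the [shift]; powers of $Q^c$ then do the rest. The minimum with [e0 - d] covers a remaining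
    modulus below $2^c$. *)
Lemma rep_exists yx (g : int) : exists d w k,
  [/\ (d <= e0)%N, (w < 2 ^ width yx d)%N &
    (rep yx d w = g * q%:Z ^+ (tau q p e yx * k) %[mod (2 ^ e0)%N])%Z].
Proof.
have [d [g' [de Eg g2]]] := odd_part_trunc_exists e0 g.
have [V [r [[V1 cV] Ew EQ _ Ek]]] := shift_spec yx.
have [u [u2 Eu]] := rep_factor yx d.
set Q := q%:Z ^+ _ in EQ Ek.
have Q2 : ~~ (2 %| Q)%Z by apply: odd_intX; lia.
have [k0 Ek0] : exists k0,
    (u = g' * Q ^+ k0 %[mod (2 ^ minn (shift yx) (e0 - d))%N])%Z.
  have [->|dn] : d = e0 \/ (d < e0)%N by lia.
    by exists 0%N; rewrite subnn minn0 !modz1.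
  have [k0 /eqP Ek0] := Ek u g' u2 (g2 dn); exists k0; apply/eqP.
  move: Ek0; rewrite !eqz_mod_dvd; apply: dvdz_trans.
  by rewrite dvdzE /= dvdn_exp2l // geq_minl.
have [|w [k [wlt Ewk]]] := rep_2adic_exists r V1 cV nprime_odd _ Ek0.
  move=> cM; rewrite even_intM negb_or odd_intX // andbT; apply: g2.
  by have := shift_gt0 yx; lia.
exists d, w, (k0 + shift yx * k)%N; split=> //; first by rewrite Ew.
rewrite Eu Eg exprM -/Q exprD exprM EQ; apply/eqP.
rewrite -mulrA modz_expn_mul2l // mulrA Ewk //.
Qed.

(** The gcd with $2^{e_0}$ is invariant under the odd [Q] and gives [d]; equal residues modulo $2^c$
    make [k] a multiple of the [shift] $c$, which reduces to [rep_2adic_unique] for $Q^c$. *)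
Lemma rep_unique yx d w d' w' k : (d <= e0)%N -> (d' <= e0)%N ->
  (w < 2 ^ width yx d)%N -> (w' < 2 ^ width yx d')%N ->
  (rep yx d' w' = rep yx d w * q%:Z ^+ (tau q p e yx * k) %[mod (2 ^ e0)%N])%Z ->
  d' = d /\ w' = w.
Proof.
move=> de de'.
have [V [r [[V1 cV] Ew EQ Ek _]]] := shift_spec yx.
have [u [u2 Eu]] := rep_factor yx d; have [u' [u2' Eu']] := rep_factor yx d'.
set Q := q%:Z ^+ _ in EQ Ek.
have Q2 : ~~ (2 %| Q)%Z by apply: odd_intX; lia.
have odd_shift v x : ~~ (2 %| v)%Z ->
    ~~ (2 %| v + (nprime p e)%:Z * (2 ^ shift yx * x)%N%:Z)%Z.
  move=> v2; rewrite PoszM mulrCA PoszX -(prednK (shift_gt0 yx)) exprS -mulrA.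
  by lia.
rewrite Eu Eu' exprM -/Q => wlt w'lt E.
have Ed : d' = d.
  have : (2 : int) ^+ d' = 2 ^+ d.
    have := gcdz_expn_mull 2 (u' + (nprime p e)%:Z * (2 ^ shift yx * w')%N%:Z) de'.
    rewrite (eqP (odd_int_coprime _ (odd_shift _ _ u2'))) mulr1 => <-.
    rewrite -gcdz_modl E gcdz_modl -mulrA gcdz_expn_mull //.
    rewrite (eqP (odd_int_coprime _ _)) ?mulr1 //.
    by rewrite even_intM negb_or odd_intX // odd_shift.
  by rewrite -!(PoszX 2) => -[] /expnI ->.
subst d'; split=> //.
move/eqP: E; rewrite -mulrA modz_expn_mul2l // => /eqP E.
(* The two uses of [rep_factor] gave separate witnesses; evaluation at $w=0$ identifies them. *)
have Euu : u' = u.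
  have := Eu 0%N; rewrite Eu' !muln0 !mulr0 !addr0 => /mulfI; apply.
  by rewrite expf_neq0.
rewrite {u' u2' Eu'}Euu in E; rewrite !Ew in wlt w'lt.
(* Here no bit is free, so both [w] and [w'] are 0. *)
have [Mc|cM] := leqP (e0 - d) (shift yx).
  have M0 : (e0 - d - shift yx = 0)%N by lia.
  by move: wlt w'lt; rewrite M0 min0n; lia.
have /dvdnP[k' Ek'] : (shift yx %| k)%N.
  apply: Ek; apply/eqP; rewrite eq_sym eqz_mod_dvd.
  move/eqP: E; rewrite eqz_mod_dvd => E.
  have {}E : ((2 ^ shift yx)%N %| u - u * Q ^+ k)%Z.
    have /dvdz_trans/(_ E) : ((2 ^ shift yx)%N %| (2 ^ (e0 - d))%N%:Z)%Z.
      by rewrite dvdzE /= dvdn_exp2l // ltnW.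
    have -> : u - u * Q ^+ k =
      (u + (nprime p e)%:Z * (2 ^ shift yx * w')%N%:Z -
        (u + (nprime p e)%:Z * (2 ^ shift yx * w)%N%:Z) * Q ^+ k) -
      (2 ^ shift yx)%N%:Z *
        ((nprime p e)%:Z * w'%:Z - (nprime p e)%:Z * w%:Z * Q ^+ k).
      by rewrite !PoszM; ring.
    by move=> dE; apply: rpredB => //; rewrite dvdz_mulr.
  move: E; rewrite -[X in X - _]mulr1 -mulrBr mulrC Gauss_dvdzl //.
  by rewrite coprimez_sym odd_int_coprime.
move: E; rewrite Ek' [(k' * _)%N]mulnC exprM EQ; apply: rep_2adic_unique => //.
- exact: nprime_odd.
- by rewrite addrAC subrr add0r PoszX dvdz_mulr.
- exact: wlt.
- exact: w'lt.
Qed.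

Definition reps (yx : pair_yx s) : set 'Z_(2 ^ e0 * nprime p e)%N :=
  [set r | exists d w,
    [/\ (d <= e0)%N, (w < 2 ^ width yx d)%N & r = (rep yx d w)%:~R]].

Lemma CR_plusE yx : Sigma_plus q p e yx -> CR_plus q e0 p e eta yx = reps yx.
Proof.
case=> _ tau1; have t1 : (q ^ tau q p e yx %% 4 == 1)%N by rewrite tau1.
have muE d (t : {ffun 'I_(s_plus q e0 p e yx d) -> bool}) :
    mu_plus eta t = rep yx d (\sum_(j < s_plus q e0 p e yx d) t j * 2 ^ j)%N.
  rewrite /mu_plus /rep /shift t1; congr (_ + _ * (_ + _)%N%:Z).
  rewrite big_distrr /=; apply: eq_bigr => j _.
  by rewrite addnS -addSn expnD addn1 mulnCA.
rewrite seteqP; split=> [r [d [t [de ->]]]|r [d [w [de]]]].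
  exists d, (\sum_(j < s_plus q e0 p e yx d) t j * 2 ^ j)%N.
  by rewrite muE /width t1 bits_lt.
rewrite /width t1 => /bits_exists[t Et] ->.
by exists d, t; rewrite muE Et.
Qed.

Lemma CR_minusE yx : Sigma_minus q p e yx -> CR_minus q e0 p e eta yx = reps yx.
Proof.
case=> _ tau3; have t3 : (q ^ tau q p e yx %% 4 == 1)%N = false by rewrite tau3.
have muE d (t : {ffun 'I_(s_minus q e0 p e yx d) -> bool}) :
    mu_minus eta t = rep yx d (\sum_(j < s_minus q e0 p e yx d) t j * 2 ^ j)%N.
  rewrite /mu_minus /rep /shift t3; congr (_ + _ * (_ + _)%N%:Z).
  rewrite big_distrr /=; apply: eq_bigr => j _.
  by rewrite mulnCA -expnD; congr (_ * 2 ^ _)%N; lia.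
rewrite seteqP; split=> [r [d [t [de ->]]]|r [d [w [de]]]].
  exists d, (\sum_(j < s_minus q e0 p e yx d) t j * 2 ^ j)%N.
  by rewrite muE /width t3 bits_lt.
rewrite /width t3 => /bits_exists[t Et] ->.
by exists d, t; rewrite muE Et.
Qed.

(** An odd $q^{\tau_y}$ is 1 or 3 modulo 4, so the two signs exhaust [Sigma] and can be treated
    together. *)
Lemma CRE (r : 'Z_(2 ^ e0 * nprime p e)%N) :
  CR q e0 p e eta r <-> exists2 yx, Sigma q p e yx & reps yx r.
Proof.
split=> [[][yx yxS]|[yx yxS]].
- by rewrite CR_plusE // => H; exists yx => //; case: yxS.
- by rewrite CR_minusE // => H; exists yx => //; case: yxS.
have : odd (q ^ tau q p e yx) by rewrite oddX q_odd orbT.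
case: (eqVneq (q ^ tau q p e yx %% 4)%N 1%N) => q4 oq H.
  have yxP : Sigma_plus q p e yx by [].
  by left; exists yx => //; rewrite CR_plusE.
have yxM : Sigma_minus q p e yx by split=> //; lia.
by right; exists yx => //; rewrite CR_minusE.
Qed.

(** * Gluing the residues modulo $2^{e_0}$ and modulo $n'$ *)

Context (p_inj : injective p) (eta_prs : primitive_root_system p e eta).

Lemma coprime_2_nprime : coprimez (2 ^ e0)%N (nprime p e).
Proof.
by rewrite coprimezE coprimeXl //= coprime2n nprime_odd.
Qed.

Lemma modz_2nprime (a b : int) : (a == b %[mod (2 ^ e0 * nprime p e)%N])%Z =
  (a == b %[mod (2 ^ e0)%N])%Z && (a == b %[mod nprime p e])%Z.
Proof. by rewrite PoszM zchinese_remainder // coprime_2_nprime. Qed.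

Lemma rep_mod_nprime yx d w :
  (rep yx d w = eta_pow p eta yx %[mod nprime p e])%Z.
Proof. by rewrite /rep addrC mulrC modzMDl. Qed.

(** The residue modulo $n'$ is settled first; powers of $q^{\tau_y}$ fix it and remain available to
    adjust the residue modulo $2^{e_0}$. *)
Lemma rep_mod_exists (g : int) : exists yx d w j,
  [/\ Sigma q p e yx, (d <= e0)%N, (w < 2 ^ width yx d)%N &
    (rep yx d w = g * q%:Z ^+ j %[mod (2 ^ e0 * nprime p e)%N])%Z].
Proof.
have [yx [j [yxS E]]] := eta_pow_exists p_prime p_inj q_coprime eta_prs g.
have [d [w [k [de wlt E2]]]] := rep_exists yx (g * q%:Z ^+ j).
exists yx, d, w, (j + tau q p e yx * k)%N; split=> //.
apply/eqP; rewrite modz_2nprime exprD mulrA E2 eqxx rep_mod_nprime /=.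
rewrite -(modz_mulr2 _ E) eta_pow_tau //; exact: dvdn_mulr.
Qed.

(** Modulo $n'$ the pair is determined and [tau] divides [j], so modulo $2^{e_0}$ only the action of
    $q^{\tau_y}$ is left. *)
Lemma rep_mod_unique yx yx' d d' w w' j :
  Sigma q p e yx -> Sigma q p e yx' -> (d <= e0)%N -> (d' <= e0)%N ->
  (w < 2 ^ width yx d)%N -> (w' < 2 ^ width yx' d')%N ->
  (rep yx' d' w' = rep yx d w * q%:Z ^+ j %[mod (2 ^ e0 * nprime p e)%N])%Z ->
  yx' = yx /\ rep yx' d' w' = rep yx d w.
Proof.
move=> yxS yxS' de de' wlt w'lt /eqP; rewrite modz_2nprime => /andP[/eqP E2].
rewrite rep_mod_nprime (modz_mulr2 _ (rep_mod_nprime _ _ _)) => /eqP.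
case/(eta_pow_unique p_prime p_inj q_coprime eta_prs yxS yxS') => Eyx.
case/dvdnP => k Ek; subst yx'; rewrite Ek mulnC in E2.
by have [-> ->] := rep_unique de de' wlt w'lt E2.
Qed.

End Representatives.

(** * Cyclotomic cosets modulo $n$ *)

Arguments reps q e0 [s] p e eta yx _.

(** Cosets use nonnegative exponents only, so $q^{-j_1}$ is replaced by $q^{(T-1)j_1}$, with $T$ the
    order of $q$ modulo $N$. *)
Lemma same_coset_expn (N q j1 j2 : nat) (a b g : int) : (0 < N)%N -> coprimez q N ->
  (a = g * q%:Z ^+ j1 %[mod N])%Z -> (b = g * q%:Z ^+ j2 %[mod N])%Z ->
  exists j, (b = a * q%:Z ^+ j %[mod N])%Z.
Proof.
move=> N0 co Ea Eb; have T0 := mord_gt0 N0 co.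
set T := mord N q in T0.
have qT : (q%:Z ^+ (T * j1) = 1 %[mod N])%Z.
  by apply/eqP; rewrite modz_expz1 // dvdn_mulr.
exists (j2 + T.-1 * j1)%N; rewrite (modz_mulr2 _ Ea) Eb -mulrA -exprD.
have -> : (j1 + (j2 + T.-1 * j1) = j2 + T * j1)%N.
  by rewrite -{2}(prednK T0) mulSn; lia.
by rewrite [in RHS]exprD mulrA -[in RHS]modzMmr qT modzMmr mulr1.
Qed.

Theorem theorem3p4 (ell a q : nat) (ell_prime : prime ell) (ell_odd : odd ell)
    (a_gt0 : (0 < a)%N) (qE : q = (ell ^ a)%N)
    (s e0 : nat) (p e : 'I_s -> nat)
    (p_prime : forall i, prime (p i)) (p_odd : forall i, odd (p i))
    (p_neq : forall i, p i <> ell) (p_inj : injective p)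
    (e0_gt0 : (0 < e0)%N) (e_gt0 : forall i, (0 < e i)%N)
    (eta : 'I_s -> int) (eta_prs : primitive_root_system p e eta) :
  [/\ trivIset (Sigma_plus q p e) (CR_plus q e0 p e eta),
      trivIset (Sigma_minus q p e) (CR_minus q e0 p e eta),
      (\bigcup_(yx in Sigma_plus q p e) CR_plus q e0 p e eta yx) `&`
      (\bigcup_(yx in Sigma_minus q p e) CR_minus q e0 p e eta yx) = set0
    & full_set_of_representatives (2 ^ e0 * nprime p e) q (CR q e0 p e eta)].
Proof.
have q_odd : odd q by rewrite qE oddX ell_odd orbT.
have q_gt1 : (1 < q)%N by rewrite qE -(exp1n a) ltn_exp2r // prime_gt1.
have q_co i : coprime q (p i).
  rewrite qE coprimeXl // prime_coprime // dvdn_prime2 //.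
  by apply/eqP => /esym; exact: p_neq.
have nprime_gt0 : (0 < nprime p e)%N by rewrite odd_gt0 // nprime_odd.
set N := (2 ^ e0 * nprime p e)%N.
have N1 : (1 < N)%N.
  by apply: leq_trans (leq_pmulr _ nprime_gt0); rewrite (ltn_exp2l 0).
have coN : coprimez q N.
  rewrite coprimezE /= /N coprimeMr coprimeXr ?coprimen2 //=.
  by rewrite /nprime; apply: coprime_prodr => i _; rewrite coprimeXr.
have unique yx yx' r r' j : Sigma q p e yx -> Sigma q p e yx' ->
    reps q e0 p e eta yx r -> reps q e0 p e eta yx' r' ->
    r' = r * (q%:Z ^+ j)%:~R -> yx' = yx /\ r' = r.
  move=> yxS yxS' [d [w [de wlt ->]]] [d' [w' [de' wlt' ->]]] /eqP.
  rewrite -intrM intr_Zp_eq // => /eqP.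
  by case/(rep_mod_unique p_prime q_co p_odd q_odd q_gt1 p_inj eta_prs
    yxS yxS' de de' wlt wlt') => -> ->.
(* The exponent 0 turns uniqueness into disjointness of the pieces. *)
have unique0 yx yx' r : Sigma q p e yx -> Sigma q p e yx' ->
    reps q e0 p e eta yx r -> reps q e0 p e eta yx' r -> yx = yx'.
  by move=> yxS yxS' H H'; have [|->] := unique yx yx' r r 0%N yxS yxS' H H';
    rewrite ?mulr1.
split.
- move=> yx yx' yxS yxS' [r []]; rewrite !CR_plusE //.
  by apply: unique0; [case: yxS | case: yxS'].
- move=> yx yx' yxS yxS' [r []]; rewrite !CR_minusE //.
  by apply: unique0; [case: yxS | case: yxS'].
- rewrite -subset0 => r [[yx yxS +] [yx' yxS' +]].
  rewrite CR_plusE // CR_minusE // => H H'.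
  case: yxS yxS' H H' => yxS q1 [yxS' q3] H H'.
  by move: q3; rewrite -(unique0 _ _ _ yxS yxS' H H') q1.
move=> C [g ->].
have [yx [d [w [j [yxS de wlt E]]]]] :=
  rep_mod_exists e0 p_prime q_co p_odd q_odd q_gt1 p_inj eta_prs g.
exists (rep q p e eta yx d w)%:~R; split.
  split; first by apply/CRE => //; exists yx => //; exists d, w.
  by exists j => //; apply/eqP; rewrite intr_Zp_eq // E.
move=> r' [/(CRE eta q_odd q_gt1)[yx' yxS' H'] [j' _ Er']].
have [d' [w' [de' wlt' Ew']]] := H'.
have [j2 E2] : exists j2, (rep q p e eta yx' d' w' =
    rep q p e eta yx d w * q%:Z ^+ j2 %[mod N])%Z.
  apply: same_coset_expn coN E _; first exact: ltnW.
  by apply/eqP; rewrite -intr_Zp_eq // -Ew' -Er'.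
have [_ Err] := rep_mod_unique p_prime q_co p_odd q_odd q_gt1 p_inj eta_prs
  yxS yxS' de de' wlt wlt' E2.
by rewrite Ew' Err.
Qed.
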